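(* Consider the distributed problem, with graph, edge weights, functions and constants as in the context: $\mathcal{G}=(\mathcal{V},\mathcal{E})$ is undirected and connected, $l,r\in\mathbb{R}^{|\mathcal{E}|}$ are element-wise positive, $X_0\subseteq\mathbb{R}^n$ is closed and convex, $\psi_0:X_0\to\mathbb{R}$ is proper, closed, continuously differentiable and $1$-strongly convex, each $f_i:X_0\to\mathbb{R}$ ($i\in\mathcal{V}$) is continuously differentiable, convex and $\beta$-smooth, and $(x^\star,u^\star)\in\mathbb{R}^{|\mathcal{V}|n}\times\mathbb{R}^{|\mathcal{E}|n}$ satisfies $$E_l(\mathcal{G})^\top x^\star=0,\qquad x^\star\in X,\qquad -E_l(\mathcal{G})u^\star-\nabla f(x^\star)\in N_X(x^\star).$$ Let $x^1\in X$, $u^1\in\mathbb{R}^{|\mathcal{E}|n}$, and let the sequences $(x^k)_{k\ge1},(u^k)_{k\ge1}$ be generated, for $k=1,2,\ldots$, by $$w^k=L_r(\mathcal{G})x^k+E_l(\mathcal{G})u^k+\nabla f(x^k)+\eta^k,$$ $$x^{k+1}=\operatorname{argmin}_{x\in X}\ \alpha^k\langle w^k,x\rangle+B_\psi(x,x^k),$$ $$u^{k+1}=u^k+\alpha^kE_l(\mathcal{G})^\top x^{k+1},$$ where $\eta^k=0$ for all $k$ and the step size is constant, $\alpha^k=\alpha$ for all $k$, with $$0<\alpha\le\min\left\{\frac{1}{\beta+\lambda},\frac1\gamma\right\}.$$ Then for every integer $K\ge1$, with $\overline{x}^K=\frac1K\sum_{k=1}^Kx^{k+1}$, $$\ell(\overline{x}^K,u^\star)-\ell(x^\star,u^\star)\le\frac{V(x^1,u^1)}{\alpha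 K}.$$
   Context: $\mathcal{G}=(\mathcal{V},\mathcal{E})$ is an undirected graph with at least one edge (an edge is a pair of distinct nodes). Fix an arbitrary orientation of its edges; the incidence matrix $E(\mathcal{G})\in\mathbb{R}^{|\mathcal{V}|\times|\mathcal{E}|}$ has, in the column indexed by an edge, entry $1$ in the row of its head, $-1$ in the row of its tail, and $0$ elsewhere. For element-wise positive $l,r\in\mathbb{R}^{|\mathcal{E}|}$, let $$E_l(\mathcal{G})=(E(\mathcal{G})\,\mathrm{diag}(\sqrt l))\otimes I_n,\qquad L_r(\mathcal{G})=(E(\mathcal{G})\,\mathrm{diag}(r)\,E(\mathcal{G})^\top)\otimes I_n,$$ where $\sqrt l$ is the element-wise square root, $\mathrm{diag}(\cdot)$ is the diagonal matrix with the given diagonal, and $\otimes$ is the Kronecker product. Let $\frac1\gamma=\max\{\alpha\in\mathbb{R}:\alpha l\le r \text{ element-wise}\}$, and let $\lambda$ be the largest eigenvalue of $L_r(\mathcal{G})$. $X=X_0^{|\mathcal{V}|}$ is the Cartesian product of $|\mathcal{V}|$ copies of $X_0$; for $x=[x_1^\top,\ldots,x_{|\mathcal{V}|}^\top]^\top\in X$ (each $x_i\in X_0$), $f(x)=\sum_{i\in\mathcal{V}}f_i(x_i)$ and $\psi(x)=\sum_{i\in\mathcal{V}}\psi_0(x_i)$. The underlying problem is to minimize $f(x)$ subject to $E_l(\mathcal{G})^\top x=0$, $x\in X$. $\psi_0$ is $1$-strongly convex if $\psi_0-\frac12\|\cdot\|_2^2$ is convex over $X_0$; $f_i$ is $\beta$-smooth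 (constant $\beta\ge0$) if $\frac\beta2\|\cdot\|_2^2-f_i$ is convex over $X_0$. The normal cone of $X$ at $x\in X$ is $N_X(x)=\{u:\langle u,x'-x\rangle\le0\ \forall x'\in X\}$. The Bregman divergence is $B_\psi(x',x)=\psi(x')-\psi(x)-\langle\nabla\psi(x),x'-x\rangle$. Lagrangian: $\ell(x,u)=f(x)+\langle E_l(\mathcal{G})u,x\rangle$. Energy function: $V(x,u)=B_\psi(x^\star,x)+\frac12\|u-u^\star\|_2^2$. *)

(* Defs.v *)
From HB Require Import structures.
From mathcomp Require Export all_boot all_order all_algebra.
From mathcomp Require Export mxtens.
From mathcomp Require Export all_classical all_reals all_analysis.

Set Implicit Arguments.
Unset Strict Implicit.
Unset Printing Implicit Defensive.

Export Order.TTheory GRing.Theory Num.Theory.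
Export numFieldNormedType.Exports.

Local Open Scope classical_set_scope.
Local Open Scope ring_scope.

(* An undirected edge is the two-element set of its end points.  Rows and columns of the incidence matrix are indexed
   through the enumerations of [V] and of the edge set [E]. *)
Section Graph.
Variable V : finType.

Definition simple_edges (E : {set {set V}}) : Prop :=
  forall e, e \in E -> #|e| = 2.

Definition adjacent (E : {set {set V}}) : rel V :=
  fun x y => [set x; y]%SET \in E.

Definition connected_graph (E : {set {set V}}) : Prop :=
  forall x y, connect (adjacent E) x y.

Definition orientation (E : {set {set V}}) (head tail : {set V} -> V) : Prop :=
  forall e, e \in E -> e = [set head e; tail e]%SET.

Variable R : realType.

Definition incidence (E : {set {set V}}) (head tail : {set V} -> V) :
    'M[R]_(#|V|, #|E|) :=
  \matrix_(i, j)
    (if enum_val i == head (enum_val j) then 1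
     else if enum_val i == tail (enum_val j) then -1 else 0).

Definition incidence_l (n : nat) (E : {set {set V}})
    (head tail : {set V} -> V) (l : 'rV[R]_#|E|) :
    'M[R]_(#|V| * n, #|E| * n) :=
  tensmx (incidence E head tail *m diag_mx (map_mx Num.sqrt l)) (1%:M : 'M[R]_n).

Definition laplacian_r (n : nat) (E : {set {set V}})
    (head tail : {set V} -> V) (r : 'rV[R]_#|E|) : 'M[R]_(#|V| * n) :=
  tensmx (incidence E head tail *m diag_mx r *m (incidence E head tail)^T)
    (1%:M : 'M[R]_n).

(* The [i]-th block of a stacked vector, laid out as in [tensmx]: entry [j] of
   block [i] has position [i * n + j]. *)
Definition block (n : nat) (x : 'cV[R]_(#|V| * n)) (i : V) : 'cV[R]_n :=
  \col_j x (mxtens_index (enum_rank i, j)) 0.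

Definition cartesian_power (n : nat) (X0 : set 'cV[R]_n) :
    set 'cV[R]_(#|V| * n) :=
  [set x | forall i, X0 (block x i)].

Definition separable_sum (n : nat) (fi : V -> 'cV[R]_n -> R)
    (x : 'cV[R]_(#|V| * n)) : R :=
  \sum_(i : V) fi i (block x i).

End Graph.

Definition is_max (R : realType) (A : set R) (m : R) : Prop :=
  A m /\ ubound A m.

(* [eigenvalue] uses row eigenvectors, which is immaterial for the symmetric
   matrices considered here. *)
Definition max_eigenvalue (R : realType) (m : nat) (A : 'M[R]_m) (a : R) :
    Prop :=
  is_max [set b | eigenvalue A b] a.

Section Euclidean.
Variables (R : realType) (m : nat).
Implicit Types (X : set 'cV[R]_m) (f : 'cV[R]_m -> R).

Definition dot (u v : 'cV[R]_m) : R := (u^T *m v) 0 0.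

Definition sqnorm (u : 'cV[R]_m) : R := dot u u.

(* A function with domain [X] is a total function whose values outside [X] are
   irrelevant, so differentiability at a point of [X] is relative to [X].  When
   [X] has empty interior a gradient is determined only up to vectors orthogonal
   to the directions of [X].  [`|_|] is the sup norm, equivalent to the
   Euclidean norm. *)
Definition gradient_on X f (g : 'cV[R]_m -> 'cV[R]_m) : Prop :=
  forall x, X x -> forall eps : R, 0 < eps ->
    \forall y \near within X (nbhs x),
      `|f y - f x - dot (g x) (y - x)| <= eps * `|y - x|.

Definition continuously_differentiable_on X f : Prop :=
  exists g, {within X, continuous g} /\ gradient_on X f g.

Definition extend_pinfty X f (x : 'cV[R]_m) : \bar R :=
  if x \in X then (f x)%:E else +oo%E.

Definition proper_on X f : Prop :=
  (forall x, (-oo < extend_pinfty X f x)%E) /\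
  exists x, (extend_pinfty X f x < +oo)%E.

Definition epigraph X f : set ('cV[R]_m * R) :=
  [set p | (extend_pinfty X f p.1 <= p.2%:E)%E].

Definition closed_on X f : Prop := closed (epigraph X f).

Definition one_strongly_convex_on X f : Prop :=
  convex_function X (fun x => f x - 2^-1 * sqnorm x).

Definition smooth_on X (beta : R) f : Prop :=
  convex_function X (fun x => beta / 2 * sqnorm x - f x).

Definition normal_cone X (x : 'cV[R]_m) : set 'cV[R]_m :=
  [set u | forall y, X y -> dot u (y - x) <= 0].

Definition bregman (psi : 'cV[R]_m -> R) (gradpsi : 'cV[R]_m -> 'cV[R]_m)
    (x' x : 'cV[R]_m) : R :=
  psi x' - psi x - dot (gradpsi x) (x' - x).

Definition argmin X f : set 'cV[R]_m :=
  [set x | X x /\ forall y, X y -> f x <= f y].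

End Euclidean.

Definition lagrangian (R : realType) (p q : nat) (El : 'M[R]_(p, q))
    (f : 'cV[R]_p -> R) (x : 'cV[R]_p) (u : 'cV[R]_q) : R :=
  f x + dot (El *m u) x.

Definition energy (R : realType) (p q : nat) (psi : 'cV[R]_p -> R)
    (gradpsi : 'cV[R]_p -> 'cV[R]_p) (xstar : 'cV[R]_p) (ustar : 'cV[R]_q)
    (x : 'cV[R]_p) (u : 'cV[R]_q) : R :=
  bregman psi gradpsi xstar x + 2^-1 * sqnorm (u - ustar).

(* Main.v *)
(* Write [q y = <y, L_r y>].  Testing the optimality of [x^{k+1}] against [x*]
   (three-point identity), and bounding [<grad f(x^k), x^{k+1} - x*>] below by
   smoothness and convexity, and [<L_r x^k, x^{k+1}>] below by polarization as
   [(q x^k + q x^{k+1} - lambda |x^{k+1} - x^k|^2) / 2], every term in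
   [|x^{k+1} - x^k|^2] is absorbed by strong convexity of [psi] since
   [alpha (beta + lambda) <= 1].  The dual update leaves the error
   [alpha^2/2 |E_l^T x^{k+1}|^2], which [alpha/2 q x^{k+1}] absorbs since
   [alpha l <= r].  Hence [alpha] times the Lagrangian gap at [x^{k+1}] is at
   most the decrease of [V]; telescope and apply Jensen. *)
Require Import Defs.
From mathcomp Require Import all_boot all_order all_algebra.
From mathcomp Require Import mxtens complex ring lra.
From mathcomp Require Import all_classical all_reals all_analysis.

Set Implicit Arguments.
Unset Strict Implicit.
Unset Printing Implicit Defensive.

Import Order.TTheory GRing.Theory Num.Theory.
Import numFieldNormedType.Exports.
Local Open Scope classical_set_scope.
Local Open Scope ring_scope.

(** * Bilinearity of the Euclidean inner product *)

Section Dot.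
Variables (R : realType) (m : nat).
Implicit Types u v w : 'cV[R]_m.

Lemma dotE u v : dot u v = \sum_i u i 0 * v i 0.
Proof. by rewrite /dot mxE; apply: eq_bigr => i _; rewrite mxE. Qed.

Lemma dotC u v : dot u v = dot v u.
Proof. by rewrite !dotE; apply: eq_bigr => i _; rewrite mulrC. Qed.

Lemma dotDl u v w : dot (u + v) w = dot u w + dot v w.
Proof. by rewrite /dot linearD mulmxDl mxE. Qed.

Lemma dotNl u w : dot (- u) w = - dot u w.
Proof. by rewrite /dot linearN mulNmx mxE. Qed.

Lemma dotZl a u w : dot (a *: u) w = a * dot u w.
Proof. by rewrite /dot linearZ -scalemxAl mxE. Qed.

Lemma dotDr u v w : dot w (u + v) = dot w u + dot w v.
Proof. by rewrite dotC dotDl ![dot w _]dotC. Qed.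

Lemma dotNr u w : dot w (- u) = - dot w u.
Proof. by rewrite dotC dotNl dotC. Qed.

Lemma dotZr a u w : dot w (a *: u) = a * dot w u.
Proof. by rewrite dotC dotZl dotC. Qed.

Lemma dot0l w : dot 0 w = 0.
Proof. by rewrite -(scale0r (0 : 'cV_m)) dotZl mul0r. Qed.

Lemma dot0r w : dot w 0 = 0.
Proof. by rewrite dotC dot0l. Qed.

Lemma sqnorm_ge0 u : 0 <= sqnorm u.
Proof. by rewrite /sqnorm dotE sumr_ge0// => i _; rewrite -expr2 sqr_ge0. Qed.

End Dot.

Definition dot_lin :=
  (dotDl, dotDr, dotNl, dotNr, dotZl, dotZr).

Lemma dot_mulmx (R : realType) (p q : nat) (A : 'M[R]_(p, q)) u v :
  dot (A *m u) v = dot u (A^T *m v).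
Proof. by rewrite /dot trmx_mul mulmxA. Qed.

(** * First-order inequalities on a convex set *)

Section FirstOrder.
Variables (R : realType) (m : nat) (X : set 'cV[R]_m).
Hypothesis cX : convex_set X.
Implicit Types (x y : 'cV[R]_m) (f : 'cV[R]_m -> R).

Lemma conv_segment x y (t : {i01 R}) :
  conv t (y : convex_lmodType 'cV[R]_m) x = x + t%:num *: (y - x).
Proof.
rewrite /conv/= scalerBl scale1r scalerBr addrC.
by rewrite -addrA; congr (_ + _); rewrite addrC.
Qed.

Lemma convex_set_segment x y t :
  X x -> X y -> 0 <= t <= 1 -> X (x + t *: (y - x)).
Proof.
move=> Xx Xy /andP[t0 t1].
by have := cX (Itv01 t0 t1) (mem_set Xy) (mem_set Xx);
  rewrite inE conv_segment.
Qed.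

Lemma convex_function_segment f x y t : convex_function X f ->
  X x -> X y -> 0 <= t <= 1 -> f (x + t *: (y - x)) <= f x + t * (f y - f x).
Proof.
move=> cf Xx Xy /andP[t0 t1].
have := cf (Itv01 t0 t1) y x (mem_set Xy) (mem_set Xx).
by rewrite conv_segment convRE /unstable.onem /= => /le_trans; apply; lra.
Qed.

(* The remainder [t ^+ 2 * d] leaves room for strong convexity, whose chord
   inequality carries the factor [t * (1 - t)]. *)
Lemma gradient_on_le f g x y c d : gradient_on X f g -> X x -> X y ->
  (forall t, 0 < t <= 1 -> f (x + t *: (y - x)) - f x <= t * c + t ^+ 2 * d) ->
  dot (g x) (y - x) <= c.
Proof.
move=> fg Xx Xy fle; apply/ler_addgt0Pr => e e0.
set N := `|y - x|.
have N0 : 0 <= N by exact: normr_ge0.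
(* Half of [e] pays for the differentiability error, half for [t * d]; each [+ 1] keeps a
   denominator positive when [N] or [d] vanishes. *)
have eps0 : 0 < e / (2 * (N + 1)) by apply: divr_gt0 => //; lra.
have /nbhs_ballP[del /= del0 Hdel] := fg x Xx _ eps0.
(* The three bounds keep the point on the segment, put it in the ball of radius [del], and give
   [t * d <= e / 2]. *)
set t := Num.min 1 (Num.min (del / (2 * (N + 1))) (e / (2 * (`|d| + 1)))).
have d0 : 0 <= `|d| by exact: normr_ge0.
have t0 : 0 < t by rewrite !lt_min ltr01 !divr_gt0//; lra.
have [t1 tdel td] :
    [/\ t <= 1, t * (2 * (N + 1)) <= del & t * (2 * (`|d| + 1)) <= e].
  have : t <= t by [].
  rewrite {2}/t !le_min => /and3P[-> /=].
  by rewrite !ler_pdivlMr//; lra.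
have t01 : 0 <= t <= 1 by rewrite ltW.
have ballx : ball x del (x + t *: (y - x)).
  rewrite -ball_normE /= opprD addNKr normrN normrZ gtr0_norm//.
  by rewrite -/N; nra.
have := Hdel _ ballx (convex_set_segment Xx Xy t01).
have -> : x + t *: (y - x) - x = t *: (y - x) by rewrite addrC addKr.
rewrite normrZ gtr0_norm// -/N dotZr ler_norml => /andP[+ _].
have := fle t; rewrite t0 t1 => /(_ isT) ft fd.
have eN : e / (2 * (N + 1)) * N <= e / 2.
  rewrite -mulrA ler_pM2l// ler_pdivrMl//; lra.
have td2 : t * d <= e / 2.
  have : t * d <= t * `|d| by rewrite ler_pM2l// ler_norm.
  lra.
have : t ^+ 2 * d <= t * (e / 2) by rewrite expr2 -mulrA ler_pM2l.
have : e / (2 * (N + 1)) * (t * N) <= t * (e / 2).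
  by rewrite mulrCA ler_pM2l.
move=> ? ?; have : t * dot (g x) (y - x) <= t * (c + e) by lra.
by rewrite ler_pM2l.
Qed.

Lemma gradient_onN f g :
  gradient_on X f g -> gradient_on X (fun x => - f x) (fun x => - g x).
Proof.
move=> fg x Xx eps eps0; apply: filterS (fg x Xx eps eps0) => y.
rewrite (_ : - f y - _ - _ = - (f y - f x - dot (g x) (y - x))) ?normrN//.
by rewrite dotNl; lra.
Qed.

Lemma gradient_on_ge f g x y c d : gradient_on X f g -> X x -> X y ->
  (forall t, 0 < t <= 1 -> t * c + t ^+ 2 * d <= f (x + t *: (y - x)) - f x) ->
  c <= dot (g x) (y - x).
Proof.
move=> fg Xx Xy fge; rewrite -lerN2 -dotNl.
apply: (gradient_on_le (d := - d) (gradient_onN fg)) => // t t01.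
by have := fge _ t01; lra.
Qed.

(* [c] may be negative: [c := - (beta / 2)], applied to [- f], gives smoothness. *)
Lemma strongly_convex_gradient f g c x y : gradient_on X f g ->
  convex_function X (fun z => f z - c * sqnorm z) -> X x -> X y ->
  f x + dot (g x) (y - x) + c * sqnorm (y - x) <= f y.
Proof.
move=> fg cf Xx Xy; suff: dot (g x) (y - x) <= f y - f x - c * sqnorm (y - x).
  lra.
(* With [S = sqnorm (y - x)], expanding the chord inequality bounds the increment by [t * (f y - f x
   - c * S) + t ^+ 2 * (c * S)], whence [d]. *)
apply: (gradient_on_le (d := c * sqnorm (y - x)) fg) => // t /andP[t0 t1].
have := convex_function_segment (t := t) cf Xx Xy.
rewrite t1 ltW// => /(_ isT).
by rewrite /sqnorm !dot_lin (dotC y x); nra.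
Qed.

Lemma smooth_gradient f g beta x y : gradient_on X f g ->
  smooth_on X beta f -> X x -> X y ->
  f y <= f x + dot (g x) (y - x) + beta / 2 * sqnorm (y - x).
Proof.
move=> fg sf Xx Xy.
have cf : convex_function X (fun z => - f z - (- (beta / 2)) * sqnorm z).
  by congr (convex_function _ _): sf; apply/funext => z; lra.
have := strongly_convex_gradient (gradient_onN fg) cf Xx Xy.
by rewrite dotNl; lra.
Qed.

Lemma convex_gradient f g x y : gradient_on X f g ->
  convex_function X f -> X x -> X y -> f x + dot (g x) (y - x) <= f y.
Proof.
move=> fg cf Xx Xy; rewrite -[leLHS]addr0 -[X in _ + X](mul0r (sqnorm (y - x))).
apply: strongly_convex_gradient => //.
by congr (convex_function _ _): cf; apply/funext => z; lra.
Qed.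

(** Minimality along the segment from [x'] to [y] bounds the increment of [psi] below by a term
    linear in [t] (hence [d := 0]); comparing slopes at [x'] and regrouping gives the three Bregman
    divergences. *)
Lemma argmin_bregman psi gradpsi v x x' y : gradient_on X psi gradpsi ->
  argmin X (fun z => dot v z + bregman psi gradpsi z x) x' -> X y ->
  dot v (x' - y) <= bregman psi gradpsi y x - bregman psi gradpsi y x'
                    - bregman psi gradpsi x' x.
Proof.
move=> gpsi [Xx' minx'] Xy.
have : dot (gradpsi x) (y - x') - dot v (y - x') <= dot (gradpsi x') (y - x').
  apply: (gradient_on_ge (d := 0) gpsi) => // t /andP[t0 t1].
  have := minx' (x' + t *: (y - x')).
  have t01 : 0 <= t <= 1 by rewrite ltW.
  move/(_ (convex_set_segment Xx' Xy t01)).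
  by rewrite /bregman !dot_lin; lra.
by rewrite /bregman !dot_lin; lra.
Qed.

Lemma convex_function_mean f (z : nat -> 'cV[R]_m) K :
  convex_function X f -> (1 <= K)%N -> (forall k, (1 <= k)%N -> X (z k)) ->
  let zbar := K%:R^-1 *: \sum_(1 <= k < K.+1) z k in
  X zbar /\ K%:R * f zbar <= \sum_(1 <= k < K.+1) f (z k).
Proof.
move=> cf + Xz; case: K => // K _ /=.
elim: K => [|K [Xm IH]].
  by rewrite !big_nat1 invr1 scale1r mul1r; split => //; exact: Xz.
rewrite !(@big_nat_recr _ _ _ K.+2)//=.
set S := \sum_(1 <= k < K.+2) z k in Xm IH *.
have K1 : K.+1%:R != 0 :> R by rewrite pnatr_eq0.
have K2 : K.+2%:R != 0 :> R by rewrite pnatr_eq0.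
(* The new mean lies on the segment from the old mean to the new point, at parameter [K.+2%:R^-1],
   so convexity along one segment suffices. *)
have -> : K.+2%:R^-1 *: (S + z K.+2) =
    K.+1%:R^-1 *: S + K.+2%:R^-1 *: (z K.+2 - K.+1%:R^-1 *: S).
  rewrite scalerDr scalerBr addrCA addrC; congr (_ + _).
  rewrite scalerA -scalerBl; congr (_ *: _).
  move: K1 K2; rewrite -(natr1 K.+1); move: (K.+1%:R : R) => c c0 c1.
  by field; rewrite c0 c1.
have t01 : 0 <= (K.+2%:R^-1 : R) <= 1.
  by apply/andP; split; rewrite ?invr_ge0 ?invf_le1 ?ltr0n ?ler0n ?ler1n.
split; first by apply: convex_set_segment => //; exact: Xz.
have := convex_function_segment cf Xm (Xz K.+2 isT) t01.
rewrite -(ler_pM2l (x := K.+2%:R)) ?ltr0n// => /le_trans; apply.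
rewrite mulrDr mulrA mulfV// mul1r.
move: IH; rewrite -(natr1 K.+1); lra.
Qed.

End FirstOrder.

(** * Rayleigh bound for real symmetric matrices *)

(** In a unitary eigenbasis the form is a sum of squared moduli weighted by eigenvalues, and the
    square norm is the same sum unweighted; they are compared term by term. *)
Lemma symmetric_quadratic_form_le (R : realType) (m : nat) (A : 'M[R]_m)
    (a : R) (x : 'cV[R]_m) :
  A^T = A -> (forall b, eigenvalue A b -> b <= a) ->
  dot (A *m x) x <= a * sqnorm x.
Proof.
move=> symA leA.
(* The spectral theorem is available only over a closed field, here [R[i]]. *)
pose toC := real_complex R.
pose B := map_mx toC A; pose z := map_mx toC x.
have realB : B \is a mxOver Num.real.
  by apply/mxOverP => i j; rewrite mxE complex_real.
have zr : map_mx Num.conj z^T = z^T.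
  by apply: realmxC; apply/mxOverP => i j; rewrite !mxE complex_real.
have herB : B \is hermsymmx.
  apply: realsym_hermsym => //.
  apply/is_hermitianmxP; rewrite scale1r map_mx_id//.
  by rewrite /B -[in LHS]symA map_trmx.
have BE := orthomx_spectralP (hermitian_normalmx herB).
set P := spectralmx B in BE; set D := spectral_diag B in BE.
have unP : P \is unitarymx := spectral_unitarymx B.
have Pu : P \in unitmx := spectral_unit B.
(* [D 0 i] is real since [B] is hermitian, and row [i] of the invertible [P] is a nonzero
   eigenvector for it; the eigenvalue then descends from [B] to [A]. *)
have leD i : exists2 b, D 0 i = toC b & b <= a.
  have : D 0 i \is Num.real.
    exact: (mxOverP (hermitian_spectral_diag_real herB)).
  case/complex_realP => b Db; exists b => //; apply: leA.
  suff: eigenvalue B (toC b) by rewrite eigenvalue_map.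
  rewrite (_ : toC b = D 0 i)//; apply/eigenvalueP; exists (row i P).
    rewrite -/B BE -row_mul !mulmxA mulmxV// mul1mx row_mul row_diag_mx.
    by rewrite -scalemxAl -rowE.
  apply/eqP => Pi0; have : delta_mx 0 i = 0 :> 'rV[R[i]]_m.
    by rewrite -[delta_mx 0 i](mulmxK Pu) -rowE Pi0 mul0mx.
  by move/matrixP/(_ 0 i)/eqP; rewrite !mxE !eqxx oner_eq0.
pose y := P *m z.
have zE : z^T *m invmx P = map_mx Num.conj y^T.
  by rewrite invmx_unitary// trmx_mul map_mxM zr map_trmx.
have conjE i : map_mx Num.conj y^T 0 i = (y i 0)^*%C.
  by rewrite 2!mxE.
have qE : toC (dot (A *m x) x) = \sum_i D 0 i * (`|y i 0| ^+ 2).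
  rewrite dotC /dot mulmxA.
  transitivity ((map_mx toC (x^T *m A *m x)) 0 0); first by rewrite [RHS]mxE.
  rewrite !map_mxM -/B -/z -map_trmx -/z BE !mulmxA zE -mulmxA -/y mxE.
  apply: eq_bigr => i _; rewrite mul_mx_diag mxE conjE.
  by rewrite normCK [_^*%C * _]mulrC -mulrA [_^*%C * _]mulrC.
have sE : toC (sqnorm x) = \sum_i `|y i 0| ^+ 2.
  rewrite /sqnorm /dot.
  transitivity ((map_mx toC (x^T *m x)) 0 0); first by rewrite [RHS]mxE.
  rewrite map_mxM -map_trmx -/z -[z in _ *m z](mulKmx Pu) (mulmxA z^T) zE -/y mxE.
  by apply: eq_bigr => i _; rewrite conjE normCK mulrC.
have : toC (dot (A *m x) x) <= toC (a * sqnorm x).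
  have -> : toC (a * sqnorm x) = toC a * toC (sqnorm x) by exact: rmorphM.
  rewrite qE sE mulr_sumr; apply: ler_sum => i _.
  have [b -> ba] := leD i.
  by rewrite ler_wpM2r ?exprn_ge0// lecR.
by rewrite lecR.
Qed.

(** * Convexity properties of separable sums *)

Section Blocks.
Variables (R : realType) (V : finType) (n : nat).
Implicit Types x y : 'cV[R]_(#|V| * n).

(** Lets the quadratic terms of smoothness and strong convexity be shared out among the summands. *)
Lemma sqnorm_block x : sqnorm x = \sum_(i : V) sqnorm (block x i).
Proof.
rewrite /sqnorm dotE.
rewrite (reindex (@mxtens_index #|V| n)) /=; last first.
  exists (@mxtens_unindex _ _) => ? _;
    by [exact: mxtens_indexK | exact: mxtens_unindexK].
transitivity (\sum_(i < #|V|) \sum_(j < n) x (mxtens_index (i, j)) 0 ^+ 2).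
  by rewrite pair_bigA; apply: eq_bigr => -[].
rewrite (reindex (@enum_rank V)) /=; last exact/onW_bij/enum_rank_bij.
by apply: eq_bigr => i _; rewrite dotE; apply: eq_bigr => j _; rewrite mxE -expr2.
Qed.

Lemma block_conv (t : {i01 R}) x y (i : V) :
  block (conv t (x : convex_lmodType 'cV[R]_(#|V| * n)) y) i =
  conv t (block x i : convex_lmodType 'cV[R]_n) (block y i).
Proof. by apply/matrixP => j k; rewrite !mxE. Qed.

Variable X0 : set 'cV[R]_n.

Lemma convex_cartesian_power :
  convex_set X0 -> convex_set (cartesian_power (V := V) X0).
Proof.
move=> cX0 x y t /set_mem Xx /set_mem Xy; apply/mem_set => i.
by rewrite block_conv; apply/set_mem/cX0; apply/mem_set.
Qed.

Lemma convex_separable_sum (fi : V -> 'cV[R]_n -> R) :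
  (forall i, convex_function X0 (fi i)) ->
  convex_function (cartesian_power (V := V) X0) (separable_sum fi).
Proof.
move=> cf t x y /set_mem Xx /set_mem Xy.
rewrite convRE /separable_sum !mulr_sumr -big_split/=; apply: ler_sum => i _.
by rewrite block_conv; apply: cf; apply/mem_set.
Qed.

Lemma smooth_separable_sum (beta : R) (fi : V -> 'cV[R]_n -> R) :
  (forall i, smooth_on X0 beta (fi i)) ->
  smooth_on (cartesian_power (V := V) X0) beta (separable_sum fi).
Proof.
move=> /convex_separable_sum; congr (convex_function _ _).
by apply/funext => x; rewrite sqnorm_block mulr_sumr /separable_sum sumrB.
Qed.

Lemma strongly_convex_separable_sum (fi : V -> 'cV[R]_n -> R) :
  (forall i, one_strongly_convex_on X0 (fi i)) ->
  one_strongly_convex_on (cartesian_power (V := V) X0) (separable_sum fi).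
Proof.
move=> /convex_separable_sum; congr (convex_function _ _).
by apply/funext => x; rewrite sqnorm_block mulr_sumr /separable_sum sumrB.
Qed.

End Blocks.

(** * Weighted incidence and Laplacian matrices *)

Section WeightedIncidence.
Variables (R : realType) (V : finType) (E : {set {set V}}).
Variables (head tail : {set V} -> V) (n : nat).
Implicit Types (l r : 'rV[R]_#|E|) (x : 'cV[R]_(#|V| * n)).

(** Splitting [r] into two factors [Num.sqrt r] exhibits the Laplacian as a Gram matrix. *)
Lemma laplacian_incidence r : (forall e, 0 <= r 0 e) ->
  laplacian_r n head tail r =
  incidence_l n head tail r *m (incidence_l n head tail r)^T.
Proof.
move=> r0; rewrite /laplacian_r /incidence_l trmx_tens tensmx_mul trmx1 mulmx1.
congr tensmx; rewrite trmx_mul tr_diag_mx -!mulmxA; congr (_ *m _).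
rewrite mulmxA mulmx_diag; congr (diag_mx _ *m _); apply/rowP => e.
by rewrite !mxE -expr2 sqr_sqrtr.
Qed.

(** Changing the weights only rescales columns, by the ratios [s], which are well defined because
    [l] is positive. *)
Lemma incidence_l_kernel l r x : (forall e, 0 < l 0 e) ->
  (incidence_l n head tail l)^T *m x = 0 ->
  (incidence_l n head tail r)^T *m x = 0.
Proof.
move=> l0 x0; pose s := \row_e (Num.sqrt (r 0 e) / Num.sqrt (l 0 e)).
suff -> : incidence_l n head tail r =
    incidence_l n head tail l *m tensmx (diag_mx s) 1%:M.
  by rewrite trmx_mul -mulmxA x0 mulmx0.
rewrite /incidence_l tensmx_mul mulmx1 -mulmxA mulmx_diag.
congr (tensmx (_ *m diag_mx _) _); apply/rowP => e.
by rewrite !mxE mulrC divfK// sqrtr_eq0 -ltNge.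
Qed.

Lemma sqnorm_incidence_l l x : (forall e, 0 <= l 0 e) ->
  sqnorm ((incidence_l n head tail l)^T *m x) =
  dot (laplacian_r n head tail l *m x) x.
Proof. by move=> l0; rewrite laplacian_incidence// -mulmxA dot_mulmx. Qed.

(** The Laplacian is linear in its weights, so the difference of the two sides is the quadratic form
    of the Laplacian with nonnegative weights [r - c *: l]. *)
Lemma sqnorm_incidence_l_le (c : R) l r x :
  (forall e, 0 <= l 0 e) -> (forall e, 0 <= r 0 e) ->
  (forall e, c * l 0 e <= r 0 e) ->
  c * sqnorm ((incidence_l n head tail l)^T *m x) <=
  sqnorm ((incidence_l n head tail r)^T *m x).
Proof.
move=> l0 r0 lr; rewrite !sqnorm_incidence_l//.
have cl0 e : 0 <= (r - c *: l) 0 e by rewrite !mxE subr_ge0.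
rewrite -subr_ge0 -dotZl -dotNl -dotDl scalemxAl -mulNmx -mulmxDl.
suff <- : laplacian_r n head tail (r - c *: l) =
    laplacian_r n head tail r - c *: laplacian_r n head tail l.
  by rewrite -sqnorm_incidence_l// sqnorm_ge0.
rewrite /laplacian_r linearB linearZ/= mulmxBr mulmxBl -scalemxAr -scalemxAl.
by apply/matrixP => i j; rewrite !mxE/= mulrBl mulrA.
Qed.

Lemma laplacian_sym r :
  (laplacian_r n head tail r)^T = laplacian_r n head tail r.
Proof.
rewrite /laplacian_r trmx_tens trmx1; congr tensmx.
by rewrite !trmx_mul trmxK tr_diag_mx mulmxA.
Qed.

End WeightedIncidence.

(** * One iteration of the method *)

(** The graph enters only through the symmetry of [Lr], the two bounds on its quadratic form, and
    the vanishing of [El^T] and [Lr] at [xstar]. *)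
Lemma energy_descent (R : realType) (p q : nat) (El : 'M[R]_(p, q))
    (Lr : 'M[R]_p) (X : set 'cV[R]_p) (f psi : 'cV[R]_p -> R)
    (gradf gradpsi : 'cV[R]_p -> 'cV[R]_p) (beta lambda alpha : R)
    (xstar x x' w : 'cV[R]_p) (ustar u : 'cV[R]_q) :
  convex_set X -> gradient_on X f gradf -> gradient_on X psi gradpsi ->
  convex_function X f -> smooth_on X beta f -> one_strongly_convex_on X psi ->
  Lr^T = Lr -> (forall y, dot (Lr *m y) y <= lambda * sqnorm y) ->
  (forall y, alpha * sqnorm (El^T *m y) <= dot (Lr *m y) y) ->
  0 < alpha -> alpha * (beta + lambda) <= 1 ->
  El^T *m xstar = 0 -> Lr *m xstar = 0 -> X xstar -> X x ->
  w = Lr *m x + El *m u + gradf x ->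
  argmin X (fun y => alpha * dot w y + bregman psi gradpsi y x) x' ->
  alpha * (lagrangian El f x' ustar - lagrangian El f xstar ustar) <=
    energy psi gradpsi xstar ustar x u -
    energy psi gradpsi xstar ustar x' (u + alpha *: (El^T *m x')).
Proof.
move=> cX df dpsi cf sf scpsi symL Lle Lge alpha0 alpha1 Exs Lxs Xxs Xx wE minx'.
have Xx' : X x' by case: minx'.
have minw : argmin X (fun y => dot (alpha *: w) y + bregman psi gradpsi y x) x'.
  by congr (argmin _ _ _): minx'; apply/funext => y; rewrite dotZl.
have prox := argmin_bregman cX dpsi minw Xxs.
have fx' := smooth_gradient cX df sf Xx Xx'.
have fxs := convex_gradient cX df cf Xx Xxs.
have psix' := strongly_convex_gradient cX dpsi scpsi Xx Xx'.
have Lx'x := Lle (x' - x).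
have Lx' := Lge x'.
(* Allows the term in [x] left by polarization to be discarded. *)
have Lx : 0 <= dot (Lr *m x) x.
  by apply: le_trans (Lge x); rewrite mulr_ge0 ?sqnorm_ge0// ltW.
have s0 := sqnorm_ge0 (x' - x).
set s := sqnorm (x' - x) in fx' psix' Lx'x s0.
have as_le : alpha * (beta + lambda) * s <= s by rewrite ler_piMl.
have LC a b : dot (Lr *m a) b = dot (Lr *m b) a.
  by rewrite dot_mulmx symL dotC.
(* Polarization: expanding the form at [x' - x] bounds the mixed term [dot (Lr *m x) x'] from
   below. *)
rewrite mulmxDr mulmxN !dot_lin (LC x' x) in Lx'x.
rewrite wE !dot_lin (LC x xstar) Lxs dot0l !(dot_mulmx El) Exs dot0r in prox.
have {psix'} Bx' : s / 2 <= bregman psi gradpsi x' x.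
  by rewrite /bregman; lra.
rewrite !dot_lin in fx' fxs.
rewrite /lagrangian /energy /sqnorm !(dot_mulmx El) Exs dot0r.
have -> : u + alpha *: (El^T *m x') - ustar = (u - ustar) + alpha *: (El^T *m x').
  by rewrite addrAC.
rewrite [u - ustar]lock !dot_lin -lock !dot_lin.
rewrite (dotC ustar u) ![dot (El^T *m x') _]dotC.
move: Lx'; rewrite /sqnorm => Lx'.
(* Once scaled by [alpha], the inequalities combine linearly, with products such as
   [alpha * beta * s] acting as atoms. *)
have {}fx' := ler_wpM2l (ltW alpha0) fx'.
have {}fxs := ler_wpM2l (ltW alpha0) fxs.
have {}Lx'x := ler_wpM2l (ltW alpha0) Lx'x.
have {}Lx := ler_wpM2l (ltW alpha0) Lx.
have {}Lx' := ler_wpM2l (ltW alpha0) Lx'.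
lra.
Qed.

(** * Telescoping and averaging over the iterations *)

Lemma convex_lagrangian (R : realType) (p q : nat) (El : 'M[R]_(p, q))
    (X : set 'cV[R]_p) (f : 'cV[R]_p -> R) (u : 'cV[R]_q) :
  convex_function X f -> convex_function X (fun y => lagrangian El f y u).
Proof.
move=> cf t y z Xy Xz; rewrite convRE /lagrangian.
have := cf t y z Xy Xz; rewrite convRE.
by rewrite [in dot _ _]/conv/= !dot_lin; lra.
Qed.

Theorem theorem1 (R : realType) (V : finType) (E : {set {set V}})
    (head tail : {set V} -> V) (n : nat)
    (l r : 'rV[R]_#|E|) (gamma lambda beta : R)
    (X0 : set 'cV[R]_n) (psi0 : 'cV[R]_n -> R) (fi : V -> 'cV[R]_n -> R)
    (gradf gradpsi : 'cV[R]_(#|V| * n) -> 'cV[R]_(#|V| * n))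
    (xstar : 'cV[R]_(#|V| * n)) (ustar : 'cV[R]_(#|E| * n))
    (x w eta : nat -> 'cV[R]_(#|V| * n)) (u : nat -> 'cV[R]_(#|E| * n))
    (alphas : nat -> R) (alpha : R) :
  let El := incidence_l n head tail l in
  let Lr := laplacian_r n head tail r in
  let X := cartesian_power (V := V) X0 in
  let f := separable_sum fi in
  let psi := separable_sum (fun _ : V => psi0) in
  simple_edges E -> (0 < #|E|)%N -> connected_graph E ->
  orientation E head tail ->
  (forall e, 0 < l 0 e) -> (forall e, 0 < r 0 e) ->
  is_max [set a : R | forall e, a * l 0 e <= r 0 e] (1 / gamma) ->
  max_eigenvalue Lr lambda ->
  closed X0 -> convex_set X0 ->
  proper_on X0 psi0 -> closed_on X0 psi0 ->
  continuously_differentiable_on X0 psi0 ->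
  one_strongly_convex_on X0 psi0 ->
  0 <= beta ->
  (forall i, continuously_differentiable_on X0 (fi i)) ->
  (forall i, convex_function X0 (fi i)) ->
  (forall i, smooth_on X0 beta (fi i)) ->
  gradient_on X f gradf -> gradient_on X psi gradpsi ->
  El^T *m xstar = 0 -> X xstar ->
  normal_cone X xstar (- (El *m ustar) - gradf xstar) ->
  X (x 1%N) ->
  (forall k, (1 <= k)%N ->
    w k = Lr *m x k + El *m u k + gradf (x k) + eta k) ->
  (forall k, (1 <= k)%N ->
    argmin X (fun y => alphas k * dot (w k) y + bregman psi gradpsi y (x k))
      (x k.+1)) ->
  (forall k, (1 <= k)%N ->
    u k.+1 = u k + alphas k *: (El^T *m x k.+1)) ->
  (forall k, (1 <= k)%N -> eta k = 0) ->
  (forall k, (1 <= k)%N -> alphas k = alpha) ->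
  0 < alpha -> alpha <= Num.min (1 / (beta + lambda)) (1 / gamma) ->
  forall K, (1 <= K)%N ->
  let xbar := K%:R^-1 *: \sum_(1 <= k < K.+1) x k.+1 in
  lagrangian El f xbar ustar - lagrangian El f xstar ustar
    <= energy psi gradpsi xstar ustar (x 1%N) (u 1%N) / (alpha * K%:R).
Proof.
move=> El Lr X f psi _ _ _ _ l0 r0 [lr _] [_ leLambda] _ cX0 _ _ _ scpsi0 _ _.
move=> cfi sfi df dpsi Exs Xxs _ Xx1 wE minx uE eta0 alphasE alpha0 alphaM K K1.
cbv zeta; set xbar := K%:R^-1 *: _.
have cX : convex_set X := convex_cartesian_power cX0.
have cf : convex_function X f := convex_separable_sum cfi.
have sf : smooth_on X beta f := smooth_separable_sum sfi.
have scpsi : one_strongly_convex_on X psi.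
  by apply: strongly_convex_separable_sum.
have l0' e : 0 <= l 0 e by exact: ltW.
have r0' e : 0 <= r 0 e by exact: ltW.
have symL : Lr^T = Lr := laplacian_sym _ _ _ _.
have Lle y : dot (Lr *m y) y <= lambda * sqnorm y.
  exact: symmetric_quadratic_form_le.
have [alphaBL alphaG] : alpha <= 1 / (beta + lambda) /\ alpha <= 1 / gamma.
  by move: alphaM; rewrite le_min => /andP.
have Lge y : alpha * sqnorm (El^T *m y) <= dot (Lr *m y) y.
  rewrite -sqnorm_incidence_l//; apply: sqnorm_incidence_l_le => // e.
  by apply: le_trans (lr e); rewrite ler_wpM2r.
have Lxs : Lr *m xstar = 0.
  rewrite /Lr laplacian_incidence// -mulmxA.
  by rewrite (incidence_l_kernel _ l0 Exs) mulmx0.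
(* Positivity of [beta + lambda] is read off from [0 < alpha <= 1 / (beta + lambda)]. *)
have alpha1 : alpha * (beta + lambda) <= 1.
  rewrite -ler_pdivlMr//; have := lt_le_trans alpha0 alphaBL.
  by rewrite div1r invr_gt0.
have Xx k : (1 <= k)%N -> X (x k).
  by case: k => // -[_ //|k _]; case: (minx k.+1 isT).
pose D k := energy psi gradpsi xstar ustar (x k) (u k).
pose gap y := lagrangian El f y ustar - lagrangian El f xstar ustar.
have step k : (1 <= k)%N -> alpha * gap (x k.+1) <= D k - D k.+1.
  move=> k1; rewrite /D /gap uE// alphasE//.
  refine (energy_descent (w := w k) ustar cX df dpsi cf sf scpsi symL Lle Lge
            alpha0 alpha1 Exs Lxs Xxs (Xx k k1) _ _).
  - by rewrite wE// eta0// addr0.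
  - by have := minx k k1; rewrite alphasE.
have sum_gap : \sum_(1 <= k < K.+1) alpha * gap (x k.+1) <= D 1%N.
  have D0 : 0 <= D K.+1.
    rewrite addr_ge0 ?mulr_ge0 ?invr_ge0 ?sqnorm_ge0//.
    have := strongly_convex_gradient cX dpsi scpsi (Xx K.+1 isT) Xxs.
    have := sqnorm_ge0 (xstar - x K.+1); rewrite /bregman; lra.
  apply: (@le_trans _ _ (D 1%N - D K.+1)); last by rewrite lerBlDr lerDl.
  (* [telescope_sumr] sums the increments [D k.+1 - D k], hence the changes of sign. *)
  rewrite -opprB -(telescope_sumr D) 1?ltnW// -sumrN.
  by rewrite !big_nat; apply: ler_sum => k /andP[k1 _]; rewrite opprB step.
have cl := convex_lagrangian El ustar cf.
(* Jensen is applied to the shifted sequence [x k.+1], as [xbar] omits the initial point. *)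
have [_ lbar] := convex_function_mean cX cl K1 (fun k _ => Xx k.+1 isT).
rewrite ler_pdivlMr ?mulr_gt0 ?ltr0n//; apply: le_trans sum_gap.
rewrite -mulr_sumr mulrCA ler_pM2l// sumrB sumr_const_nat subn1 /=.
by rewrite -[_ *+ K]mulr_natr; rewrite -/xbar in lbar; lra.
Qed.
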